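(* Let $0<\lambda<\frac12$ and let $X$ be a $d$-dimensional $(d+1)$-partite simplicial complex that is a $\frac{\lambda}{(d+1)\lambda+1}$-one-sided link expander. Let $I,J\subseteq\{0,\dots,d\}$ be nonempty disjoint color sets, and let $C^{I,J}$ be the bipartite operator of the $(I,J)$-colored walk. Then $$\lambda(C^{I,J})\le|I|\,|J|\,\lambda.$$
   Context: **Weighted simplicial complexes.** $X(k)$ denotes the faces of size $k+1$, weighted via a distribution on $X(d)$: choose a $d$-face, then a uniform chain of subfaces. Links are $X_s=\{u\setminus s:s\subseteq u\in X\}$ with conditional measures. **Link expansion.** $X$ is a $\mu$-one-sided link expander if for every $-1\le k\le d-2$ and $s\in X(k)$, the second largest eigenvalue of the random walk on the underlying graph of $X_s$ (vertices $X_s(0)$, edges $X_s(1)$) is at most $\mu$. **Partite complexes and colors.** $X$ is $(d+1)$-partite if $X(0)=V_0\sqcup\dots\sqcup V_d$ and every $d$-face has exactly one vertex in each $V_i$. The color of a face $s$ is $\mathrm{col}(s)=\{i:s\cap V_i\neq\emptyset\}$, and $X[I]=\{s\in X:\mathrm{col}(s)=I\}$, with the measure on $X[I]$ conditioned on color $I$. **Colored walk.** The $(I,J)$-colored walk is the bipartite graph $L=X[I]$, $R=X[J]$ with edges $(s,t)$ such that $s\sqcup t\in X[I\sqcup J]$, chosen with probability proportional to the measure of $s\sqcup t$ in $X[I\sqcup J]$. **Bipartite expansion.** $\lambda(B)=\sup\{\langle Bf,g\rangle:\|f\|=\|g\|=1,\ f\perp\text{constants}\}$ for the bipartite averaging operator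 $Bf(v)=\mathbb E_{w\sim v}f(w)$. *)

(* Defs.v *)
From HB Require Import structures.
From mathcomp Require Import all_boot all_order all_algebra.
Set Implicit Arguments. Unset Strict Implicit. Unset Printing Implicit Defensive.
Import Order.TTheory GRing.Theory Num.Theory.
Local Open Scope ring_scope.

Section SimplicialDefs.
Variables (R : rcfType) (V : finType).

(** A weighted d-dimensional complex is given by a probability distribution
    [w] on the top faces X(d) (sets of d+1 vertices); X is the downward closure
    of the support of [w]. *)
Definition is_weighted_complex (d : nat) (w : {set V} -> R) : Prop :=
  (forall t, 0 <= w t) /\ (\sum_t w t = 1) /\
  (forall t, 0 < w t -> #|t| = d.+1).

(** Total weight of the top faces containing s.  The measure of s in X(k)
    (|s| = k+1) is [Wt w s / 'C(d+1, k+1)]; s is a face of X iff [0 < Wt w s]. *)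
Definition Wt (w : {set V} -> R) (s : {set V}) : R :=
  \sum_(t : {set V} | s \subset t) w t.

Definition is_face (w : {set V} -> R) (s : {set V}) : bool := 0 < Wt w s.

Definition link_vert (w : {set V} -> R) (s : {set V}) : {set V} :=
  [set v | (v \notin s) && (0 < Wt w (v |: s))].

(** Random walk on the underlying graph of the link X_s: from v move to a
    neighbour u with probability proportional to the (link) weight of the
    edge {v,u}, which is proportional to the weight of s u {v,u} in X. *)
Definition link_walk (w : {set V} -> R) (s : {set V}) (v u : V) : R :=
  if (u != v) && (u \in link_vert w s) then
    Wt w (u |: (v |: s)) /
      (\sum_(u' in link_vert w s | u' != v) Wt w (u' |: (v |: s)))
  else 0.

Definition link_walk_mx (w : {set V} -> R) (s : {set V})
  : 'M[R]_#|link_vert w s| :=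
  \matrix_(i, j) link_walk w s (enum_val i) (enum_val j).

(** "The second largest eigenvalue (with multiplicity) of M is at most mu":
    listing the eigenvalues of M with multiplicity (roots of the
    characteristic polynomial), at most one of them exceeds mu. *)
Definition second_eig_le (n : nat) (M : 'M[R]_n) (mu : R) : Prop :=
  exists r : seq R, char_poly M = \prod_(a <- r) ('X - a%:P) /\
                    (count (fun a : R => (mu < a)%R) r <= 1)%N.

Definition one_sided_link_expander (d : nat) (w : {set V} -> R) (mu : R)
  : Prop :=
  forall s : {set V}, is_face w s -> (#|s|.+1 <= d)%N ->
    second_eig_le (link_walk_mx w s) mu.

Definition is_partite (d : nat) (w : {set V} -> R) (col : V -> 'I_d.+1)
  : Prop :=
  forall t, 0 < w t -> forall i : 'I_d.+1, #|[set v in t | col v == i]| = 1%N.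

Definition colface (d : nat) (w : {set V} -> R) (col : V -> 'I_d.+1)
  (I : {set 'I_d.+1}) (s : {set V}) : bool :=
  is_face w s && (col @: s == I).

Definition meas_col (d : nat) (w : {set V} -> R) (col : V -> 'I_d.+1)
  (I : {set 'I_d.+1}) (s : {set V}) : R :=
  if colface w col I s then
    Wt w s / (\sum_(s' : {set V} | colface w col I s') Wt w s')
  else 0.

Definition ip_col (d : nat) (w : {set V} -> R) (col : V -> 'I_d.+1)
  (I : {set 'I_d.+1}) (f g : {set V} -> R) : R :=
  \sum_(s : {set V} | colface w col I s) meas_col w col I s * f s * g s.

Definition norm_col (d : nat) (w : {set V} -> R) (col : V -> 'I_d.+1)
  (I : {set 'I_d.+1}) (f : {set V} -> R) : R :=
  Num.sqrt (ip_col w col I f f).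

Definition col_edge (d : nat) (w : {set V} -> R) (col : V -> 'I_d.+1)
  (I J : {set 'I_d.+1}) (s t : {set V}) : bool :=
  [&& colface w col I s, colface w col J t, [disjoint s & t] &
      colface w col (I :|: J) (s :|: t)].

Definition colwalk_op (d : nat) (w : {set V} -> R) (col : V -> 'I_d.+1)
  (I J : {set 'I_d.+1}) (f : {set V} -> R) (s : {set V}) : R :=
  (\sum_(t : {set V} | col_edge w col I J s t)
      meas_col w col (I :|: J) (s :|: t) * f t) /
  (\sum_(t : {set V} | col_edge w col I J s t)
      meas_col w col (I :|: J) (s :|: t)).

Definition colwalk_lambda_le (d : nat) (w : {set V} -> R)
  (col : V -> 'I_d.+1) (I J : {set 'I_d.+1}) (c : R) : Prop :=
  forall f g : {set V} -> R,
    norm_col w col J f = 1 -> norm_col w col I g = 1 ->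
    ip_col w col J f (fun _ => 1) = 0 ->
    ip_col w col I (colwalk_op w col I J f) g <= c.

End SimplicialDefs.

(* Main.v *)
Require Import Defs.
From HB Require Import structures.
From mathcomp Require Import all_boot all_order all_algebra.
From mathcomp Require Import ring lra.
From mathcomp Require complex.
Import Order.TTheory GRing.Theory Num.Theory.
Set Implicit Arguments. Unset Strict Implicit. Unset Printing Implicit Defensive.
Local Open Scope ring_scope.

(** A function on X[I] is viewed as a random variable F on the top faces that
    depends only on the vertices with colors in I, so that the bound on the
    colored walk reads [2 cov(F, G) <= c (Var F + Var G)], and a link is the
    conditioning of the top-face distribution on the vertices of some colors K.

    In the link of a face with m + 1 missing colors, expansion applied to a
    function supported on the color classes i and j gives the bound with
    [c = m mu].  This is improved to about [mu / (1 - (m - 1) mu)] by trickling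
    down: conditioning on a third color k, the law of total covariance turns a
    bound [g] in the smaller links and a bound [eta] at the current level into
    the bound [g + (1 - g) eta^2] at the current level.  The best [eta] would
    satisfy [eta <= g / (1 - g)]; as a supremum need not exist in a real closed
    field, the improvement is instead
    iterated finitely often, using that the hypothesis on mu leaves
    room for [d + 1] steps whereas only [d - 1] are taken.

    Finally, conditioning on one color j of J at a time, the law of total
    covariance shows that the bounds for (I, J \ j) in the links and for (I, j)
    add up, which gives the factor |I| |J|. *)

(** * Spectral bound on quadratic forms *)

(** The determinant of [P] over the polynomials is nonzero and can be cancelled. *)
Lemma char_poly_intertwine (F : fieldType) n (A B P : 'M[F]_n) :
  P \in unitmx -> A *m P = P *m B -> char_poly A = char_poly B.
Proof.
move=> uP AP.
have dP : \det (map_mx polyC P) != 0.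
  by rewrite det_map_mx polyC_eq0 -unitfE -unitmxE.
apply: (mulIf dP); rewrite /char_poly -det_mulmx [RHS]mulrC -det_mulmx.
congr (\det _); rewrite /char_poly_mx mulmxBl mulmxBr -!map_mxM AP.
by rewrite mul_scalar_mx mul_mx_scalar.
Qed.

Section Rayleigh.
Import complex Num.Def.
Local Open Scope complex_scope.
Local Open Scope sesquilinear_scope.

(** Diagonalize [S] unitarily over [R[i]]. As [v] is an eigenvector for the eigenvalue 1, which
    exceeds [mu], it uses up the one eigenvalue above [mu] that is allowed; [x], orthogonal to [v],
    only has components with eigenvalue at most [mu]. *)
Lemma rayleigh_second_eig (R : rcfType) n (S : 'M[R]_n) (mu : R)
    (v x : 'rV[R]_n) :
  S^T = S -> second_eig_le S mu -> mu < 1 -> v *m S = v -> v != 0 ->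
  x *m v^T = 0 -> (x *m S *m x^T) 0 0 <= mu * (x *m x^T) 0 0.
Proof.
move=> symS [r [rP r1]] mu1 vS v0 xv.
pose c : {rmorphism R -> R[i]} := real_complex R.
have cJ m p (B : 'M[R]_(m, p)) : (map_mx c B) ^t* = map_mx c B^T.
  by apply/matrixP=> i j; rewrite !mxE conj_Creal //; apply/complex_realP; exists (B j i).
pose A := map_mx c S.
have An : A \is normalmx by apply/normalmxP; rewrite /A cJ symS.
pose P := spectralmx A; pose D := spectral_diag A.
have uP : P \is unitarymx := spectral_unitarymx A.
have AE : A = P ^t* *m diag_mx D *m P.
  by rewrite -(invmx_unitary uP); apply/orthomx_spectralP.
have PK : P ^t* *m P = 1%:M by rewrite -(invmx_unitary uP) mulVmx ?unitarymx_unit.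
have KP : P *m P ^t* = 1%:M by apply/unitarymxP.
have cpA : char_poly A = \prod_(i < n) ('X - (D 0 i)%:P).
  rewrite (@char_poly_intertwine _ _ A (diag_mx D) (P ^t*)); last first.
  - by rewrite AE -!mulmxA KP mulmx1.
  - by rewrite -(invmx_unitary uP) unitmx_inv unitarymx_unit.
  rewrite char_poly_trig; last exact/diag_mx_is_trig.
  by apply: eq_bigr => i _; rewrite mxE eqxx.
(* Both lists are the roots of one characteristic polynomial, so the entries of [D] are real and at
   most one exceeds [mu]. *)
have pe : perm_eq (map c r) [seq D 0 i | i <- enum 'I_n].
  apply: prod_XsubC_eq; rewrite (big_map c) (big_map (fun i => D 0 i)) big_enum -cpA -map_char_poly rP.
  by rewrite rmorph_prod; apply: eq_bigr => i _; rewrite rmorphB /= map_polyX map_polyC.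
have cntD : (#|[pred i | (c mu < D 0 i)%R]| <= 1)%N.
  apply: leq_trans r1; rewrite cardE /enum_mem size_filter -enumT.
  have := permP pe (fun z => c mu < z); rewrite !count_map => pc.
  rewrite -(eq_count (a1 := preim (fun i => D 0 i) (fun z => c mu < z))) // -pc.
  by rewrite (eq_count (a2 := fun a => mu < a)) // => a; rewrite /= ltcR.
have Dr i : exists2 a, D 0 i = c a & (c mu < D 0 i) = (mu < a).
  have : D 0 i \in map c r by rewrite (perm_mem pe) map_f ?mem_enum.
  by case/mapP => a _ ->; exists a => //; rewrite ltcR.
have coord (u : 'rV[R]_n) : map_mx c u = (map_mx c u *m P ^t*) *m P.
  by rewrite -mulmxA PK mulmx1.
pose z := map_mx c v *m P ^t*; pose y := map_mx c x *m P ^t*.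
have zD i : z 0 i * (D 0 i - 1) = 0.
  have : z *m diag_mx D = z.
    rewrite /z -[in RHS]vS map_mxM -/A AE -!mulmxA; congr (_ *m _).
    by rewrite KP mulmx1.
  move/rowP/(_ i); rewrite mul_mx_diag mxE => e.
  by rewrite mulrBr e mulr1 subrr.
have [k zk] : exists k, z 0 k != 0.
  apply/existsP; apply: contraNT v0 => /existsPn z0.
  have z00 : z = 0 by apply/rowP => i; rewrite [RHS]mxE; apply/eqP; rewrite -[_ == _]negbK z0.
  by rewrite -(map_mx_eq0 c) coord -/z z00 mul0mx.
have Dk : D 0 k = 1.
  by move/eqP: (zD k); rewrite mulf_eq0 (negPf zk) subr_eq0 => /eqP.
have kbig : c mu < D 0 k by rewrite Dk -(rmorph1 c) ltcR.
have small i : i != k -> D 0 i <= c mu.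
  move=> ik; have [a Da lta] := Dr i.
  rewrite Da lecR leNgt -lta; apply/negP => ibig.
  by move/card_le1_eqP: cntD => /(_ i k ibig kbig) ki; rewrite ki eqxx in ik.
have z0 i : i != k -> z 0 i = 0.
  move=> ik; have /eqP := zD i; rewrite mulf_eq0 subr_eq0 => /orP [/eqP //|/eqP Di].
  have := le_lt_trans (small i ik) kbig.
  by rewrite Di Dk ltxx.
have tcE (u : 'rV[R[i]]_n) i : (u ^t*) i 0 = (u 0 i)^*%R by rewrite !mxE.
have yk : y 0 k = 0.
  have : (y *m z ^t*) 0 0 = 0.
    rewrite /y /z trmx_mul map_mxM trmxCK mulmxA -(mulmxA _ _ P) PK mulmx1 cJ -map_mxM xv.
    by rewrite map_mx0 mxE.
  rewrite mxE (bigD1 k) //= big1 => [|i ik].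
    rewrite addr0 tcE => /eqP; rewrite mulf_eq0 conjC_eq0 (negPf zk) orbF.
    by move/eqP.
  by rewrite tcE z0 // conjC0 mulr0.
have q1 : c ((x *m S *m x^T) 0 0) = \sum_i D 0 i * (y 0 i * (y 0 i)^*%R).
  have -> : c ((x *m S *m x^T) 0 0) = (map_mx c (x *m S *m x^T)) 0 0 by rewrite [RHS]mxE.
  have -> : map_mx c (x *m S *m x^T) = y *m diag_mx D *m y ^t*.
    rewrite !map_mxM -/A AE -cJ /y trmx_mul map_mxM trmxCK.
    by rewrite !mulmxA.
  rewrite mxE; apply: eq_bigr => i _.
  by rewrite mul_mx_diag mxE tcE; ring.
have q2 : c ((x *m x^T) 0 0) = \sum_i (y 0 i * (y 0 i)^*%R).
  have -> : c ((x *m x^T) 0 0) = (map_mx c (x *m x^T)) 0 0 by rewrite [RHS]mxE.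
  have -> : map_mx c (x *m x^T) = y *m y ^t*.
    rewrite !map_mxM -cJ /y trmx_mul map_mxM trmxCK mulmxA.
    by rewrite -(mulmxA _ _ P) PK mulmx1.
  by rewrite mxE; apply: eq_bigr => i _; rewrite tcE.
rewrite -lecR -/c (rmorphM c) q1 q2 mulr_sumr; apply: ler_sum => i _.
have [->|ik] := eqVneq i k; first by rewrite yk mul0r !mulr0.
by apply: ler_wpM2r (small i ik); rewrite -normCK exprn_ge0.
Qed.

End Rayleigh.

(** * Covariance and conditioning *)

Section Covariance.
Variables (R : rcfType) (T : finType).
Implicit Types (u : T -> R) (F G H : T -> R).

(* Weights are not normalized; when they all vanish, [cov] is 0 since x / 0 = 0. *)
Definition expect u F : R := \sum_t u t * F t.

Definition cov u F G : R :=
  expect u (fun t => F t * G t) - expect u F * expect u G / expect u (fun=> 1).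

Lemma eq_expect u u' F F' : u =1 u' -> (forall t, u t != 0 -> F t = F' t) ->
  expect u F = expect u' F'.
Proof.
move=> eu eF; apply: eq_bigr => t _; rewrite -eu.
by have [->|/eF ->] := eqVneq (u t) 0; rewrite ?mul0r.
Qed.

Lemma eq_cov u u' F F' G G' : u =1 u' ->
  (forall t, u t != 0 -> F t = F' t) -> (forall t, u t != 0 -> G t = G' t) ->
  cov u F G = cov u' F' G'.
Proof.
move=> eu eF eG; rewrite /cov.
rewrite (eq_expect eu eF) (eq_expect eu eG) (eq_expect (F := fun=> 1) eu (fun _ _ => erefl)).
congr (_ - _); apply: (eq_expect eu) => t ut.
by rewrite eF ?eG.
Qed.

Lemma covC u F G : cov u F G = cov u G F.
Proof.
rewrite /cov [expect u F * _]mulrC; congr (_ - _).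
by apply: eq_bigr => t _; rewrite [F t * _]mulrC.
Qed.

Lemma expectD u F G a : expect u (fun t => F t + a * G t) = expect u F + a * expect u G.
Proof.
by rewrite /expect mulr_sumr -big_split /=; apply: eq_bigr => t _; ring.
Qed.

Lemma covDr u F G H a : cov u H (fun t => F t + a * G t) = cov u H F + a * cov u H G.
Proof.
rewrite /cov expectD.
have -> : expect u (fun t => H t * (F t + a * G t)) =
    expect u (fun t => H t * F t) + a * expect u (fun t => H t * G t).
  by rewrite -expectD; apply: eq_bigr => t _; ring.
by ring.
Qed.

Lemma covZr u F G a : cov u F (fun t => a * G t) = a * cov u F G.
Proof.
rewrite /cov.
have -> : expect u (fun t => F t * (a * G t)) = a * expect u (fun t => F t * G t).
  by rewrite /expect mulr_sumr; apply: eq_bigr => t _; ring.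
have -> : expect u (fun t => a * G t) = a * expect u G.
  by rewrite /expect mulr_sumr; apply: eq_bigr => t _; ring.
by ring.
Qed.

Section Nonneg.
Variables (u : T -> R) (u0 : forall t, 0 <= u t).

Lemma expect_null F : expect u (fun=> 1) = 0 -> expect u F = 0.
Proof.
move=> /eqP; rewrite psumr_eq0 => [/allP z|t _]; last by rewrite mulr1.
apply: big1 => t _; have := z t (mem_index_enum t).
by rewrite mulr1 => /eqP ->; rewrite mul0r.
Qed.

Lemma var_ge0 F : 0 <= cov u F F.
Proof.
have [W0|W0] := eqVneq (expect u (fun=> 1)) 0.
  by rewrite /cov W0 invr0 mulr0 subr0 sumr_ge0 // => t _; rewrite mulr_ge0 // -expr2 sqr_ge0.
set W := expect u _ in W0; pose m := expect u F / W.
suff -> : cov u F F = expect u (fun t => (F t - m) * (F t - m)).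
  by rewrite sumr_ge0 // => t _; rewrite mulr_ge0 // -expr2 sqr_ge0.
have -> : expect u (fun t => (F t - m) * (F t - m)) =
    expect u (fun t => (F t * F t + (- (m + m)) * F t) + m ^+ 2 * 1).
  by apply: eq_bigr => t _; ring.
rewrite !expectD /cov -/W /m; by field.
Qed.

Lemma cov_le_var F G : 2 * cov u F G <= cov u F F + cov u G G.
Proof.
have := var_ge0 (fun t => F t + (-1) * G t).
by rewrite !covDr ![cov u (fun t => _ + _) _]covC !covDr [cov u G F]covC; lra.
Qed.

End Nonneg.

Section Conditioning.
Variables (A : finType) (X : T -> A).

(** Not rescaled by the weight of the fibre, so that expectations over the fibres add up to the
    total. *)
Definition cnd u x t : R := if X t == x then u t else 0.

Definition cmean u F t : R :=
  expect (cnd u (X t)) F / expect (cnd u (X t)) (fun=> 1).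

Lemma expect_cnd u F : expect u F = \sum_x expect (cnd u x) F.
Proof.
rewrite /expect exchange_big; apply: eq_bigr => t _.
rewrite (bigD1 (X t)) //= big1 => [|x]; first by rewrite /cnd eqxx addr0.
by rewrite /cnd eq_sym => /negPf ->; rewrite mul0r.
Qed.

Variables (u : T -> R) (u0 : forall t, 0 <= u t).

Lemma cnd_ge0 x t : 0 <= cnd u x t.
Proof. by rewrite /cnd; case: ifP. Qed.

(** Tower property, checked fibre by fibre: both [cmean] and [h] of [X] are constant there. On a
    fibre of weight 0 both sides vanish. *)
Lemma expect_cmean F (h : A -> R) :
  expect u (fun t => cmean u F t * h (X t)) = expect u (fun t => F t * h (X t)).
Proof.
rewrite expect_cnd [RHS]expect_cnd; apply: eq_bigr => x _.
have cX t : cnd u x t != 0 -> X t = x by rewrite /cnd; case: (X t =P x) => //; rewrite eqxx.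
set W := expect (cnd u x) (fun=> 1).
transitivity (expect (cnd u x) (fun=> expect (cnd u x) F / W * h x)).
  by apply: eq_expect => // t /cX; rewrite /cmean => ->.
transitivity (expect (cnd u x) F / W * h x * W).
  by rewrite /W /expect [RHS]mulr_sumr; apply: eq_bigr => t _; rewrite mulr1 mulrC.
transitivity (expect (cnd u x) F * h x); last first.
  by rewrite /expect mulr_suml; apply: eq_bigr => t _;
    have [->|/cX ->] := eqVneq (cnd u x t) 0; ring.
have [W0|W0] := eqVneq W 0; last by field.
by rewrite W0 mulr0 (expect_null (cnd_ge0 x) F W0) mul0r.
Qed.

Lemma cov_cmean F (h : A -> R) :
  cov u (cmean u F) (fun t => h (X t)) = cov u F (fun t => h (X t)).
Proof.
rewrite /cov expect_cmean; have := expect_cmean F (fun=> 1).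
have e H : expect u (fun t => H t * 1) = expect u H by apply: eq_bigr => t _ /=; rewrite mulr1.
by rewrite !e => ->.
Qed.

Lemma cov_cmean2 F G :
  cov u (cmean u F) (cmean u G) = cov u F (cmean u G).
Proof.
exact: (cov_cmean F (fun x => expect (cnd u x) G / expect (cnd u x) (fun=> 1))).
Qed.

Lemma total_cov F G : cov u F G =
  \sum_x cov (cnd u x) F G + cov u (cmean u F) (cmean u G).
Proof.
rewrite cov_cmean2 [cov u F (cmean u G)]/cov /cov big_split /= -expect_cnd sumrN.
have := expect_cmean G (fun=> 1).
have e H : expect u (fun t => H t * 1) = expect u H by apply: eq_bigr => t _ /=; rewrite mulr1.
rewrite !e => ->.
suff -> : \sum_x (expect (cnd u x) F * expect (cnd u x) G / expect (cnd u x) (fun=> 1)) =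
   expect u (fun t => F t * cmean u G t) by ring.
rewrite [RHS]expect_cnd; apply: eq_bigr => x _.
rewrite -mulrA /expect mulr_suml; apply: eq_bigr => t _; rewrite -mulrA /cmean.
by have [->|] := eqVneq (cnd u x t) 0; rewrite ?mul0r // {1}/cnd; case: (X t =P x) => [->|]; rewrite ?eqxx.
Qed.

Lemma total_var F :
  cov u F F = \sum_x cov (cnd u x) F F + cov u (cmean u F) (cmean u F).
Proof. exact: total_cov. Qed.

Lemma var_cmean_le F : cov u (cmean u F) (cmean u F) <= cov u F F.
Proof.
by rewrite [leRHS]total_cov lerDr sumr_ge0 // => x _; apply/var_ge0/cnd_ge0.
Qed.

Lemma sum_var_cnd_le F : \sum_x cov (cnd u x) F F <= cov u F F.
Proof. by rewrite [leRHS]total_cov lerDl var_ge0. Qed.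

End Conditioning.
End Covariance.

(** * Expansion between sets of coordinates *)

Section Coordinates.
Variables (R : rcfType) (T C A : finType) (r : C -> T -> A) (w : T -> R).
Hypothesis w0 : forall t, 0 <= w t.
Implicit Types (I J K : {set C}) (F G : T -> R).

Definition agree K t t' := [forall i in K, r i t == r i t'].

Definition depends_on K F := forall t t', agree K t t' -> F t = F t'.

Definition pinned K t0 t : R := if agree K t0 t then w t else 0.

(* The links with free colors outside K, in which the vertices of the colors in
   K are frozen; hence functions may depend on those colors as well. *)
Definition expands K I J (c : R) := forall t0 F G,
  depends_on (K :|: I) F -> depends_on (K :|: J) G ->
  2 * cov (pinned K t0) F G <=
    c * (cov (pinned K t0) F F + cov (pinned K t0) G G).

Lemma pinned_ge0 K t0 t : 0 <= pinned K t0 t.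
Proof. by rewrite /pinned; case: ifP. Qed.
Hint Resolve pinned_ge0 : core.

Lemma agreeP K t t' :
  reflect (forall i, i \in K -> r i t = r i t') (agree K t t').
Proof. exact: 'forall_in_eqP. Qed.

Lemma depends_sub K K' F : K \subset K' -> depends_on K F -> depends_on K' F.
Proof.
move=> /subsetP KK' dF t t' /agreeP a; apply: dF; apply/agreeP => i iK.
exact/a/KK'.
Qed.

Lemma depends_cmean K k u F : k \in K -> depends_on K (cmean (r k) u F).
Proof. by move=> kK t t' /agreeP /(_ k kK); rewrite /cmean => ->. Qed.

(** A link of a link is a link, with a new base point [t1]. The null case arises when no point
    agreeing with [t0] on [K] has the value [x]. *)
Lemma cnd_pinned K t0 k x :
  (exists t1, cnd (r k) (pinned K t0) x =1 pinned (k |: K) t1) \/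
  cnd (r k) (pinned K t0) x =1 fun=> 0.
Proof.
have [/existsP [t1 /andP [a1 /eqP rx]]|/existsPn no] :=
  boolP [exists t1, agree K t0 t1 && (r k t1 == x)]; [left|right].
  exists t1 => t; rewrite /cnd /pinned.
  have -> : agree (k |: K) t1 t = (r k t == x) && agree K t0 t.
    apply/agreeP/andP => [a|[/eqP rt /agreeP a] i].
      split; first by rewrite -(a k) ?setU11 // rx.
      by apply/agreeP => i iK; rewrite -a ?setU1r //; apply/(agreeP _ _ _ a1).
    by rewrite in_setU1 => /orP [/eqP ->|iK]; rewrite ?rt // -a //;
      apply/esym/(agreeP _ _ _ a1).
  by case: eqP.
move=> t; rewrite /cnd /pinned; case: eqP => // rx; case: ifP => // a0.
by have := no t; rewrite a0 rx eqxx.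
Qed.

Lemma cov_cnd_le K I J k c : expands (k |: K) I J c ->
  forall t0 F G, depends_on (k |: K :|: I) F -> depends_on (k |: K :|: J) G ->
  forall x, let u := cnd (r k) (pinned K t0) x in
  2 * cov u F G <= c * (cov u F F + cov u G G).
Proof.
move=> eK t0 F G dF dG x /=.
have [[t1 e]|e] := cnd_pinned K t0 k x.
  by rewrite !(eq_cov e (fun _ _ => erefl) (fun _ _ => erefl)); apply: eK.
have z F' G' : cov (cnd (r k) (pinned K t0) x) F' G' = 0.
  rewrite (eq_cov e (fun _ _ => erefl) (fun _ _ => erefl)) /cov.
  have e0 (H : T -> R) : expect (fun=> 0) H = 0 by apply: big1 => t _; rewrite mul0r.
  by rewrite !e0 !mul0r subr0.
by rewrite !z addr0 !mulr0.
Qed.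

Lemma expands_sym K I J c : expands K I J c -> expands K J I c.
Proof.
move=> e t0 F G dF dG; rewrite covC addrC; exact: e.
Qed.

Lemma expands_le K I J c c' : c <= c' -> expands K I J c -> expands K I J c'.
Proof.
move=> cc' e t0 F G dF dG; apply: le_trans (e t0 F G dF dG) _.
by apply: ler_wpM2r => //; rewrite addr_ge0 // var_ge0.
Qed.

(** Total covariance over the coordinate [j]. Inside the fibres [c1] applies, and fibre variances
    sum to at most the variance. The part between fibres is the covariance of [F] with the
    conditional mean of [G], a function of [j] alone, so [c2] applies. *)
Lemma expands_add K I J j c1 c2 : 0 <= c1 -> 0 <= c2 ->
  expands (j |: K) I J c1 -> expands K I [set j] c2 ->
  expands K I (j |: J) (c1 + c2).
Proof.
move=> c10 c20 e1 e2 t0 F G dF dG.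
set u := pinned K t0; have u0 : forall t, 0 <= u t by move=> t; apply: pinned_ge0.
have le1 : 2 * \sum_x cov (cnd (r j) u x) F G <= c1 * (cov u F F + cov u G G).
  apply: (@le_trans _ _ (c1 * \sum_x (cov (cnd (r j) u x) F F + cov (cnd (r j) u x) G G))).
    rewrite !mulr_sumr; apply: ler_sum => x _.
    apply: (cov_cnd_le e1); apply: depends_sub (dF) || apply: depends_sub (dG).
      by rewrite setUSS // subsetUr.
    by rewrite setUCA setUA.
  apply: ler_wpM2l => //; rewrite big_split.
  by apply: lerD; apply: sum_var_cnd_le.
have le2 : 2 * cov u F (cmean (r j) u G) <= c2 * (cov u F F + cov u G G).
  apply: (@le_trans _ _ (c2 * (cov u F F + cov u (cmean (r j) u G) (cmean (r j) u G)))).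
    by apply: e2 => //; apply: depends_cmean; rewrite in_setU set11 orbT.
  by apply: ler_wpM2l => //; rewrite lerD2l var_cmean_le.
by rewrite (total_cov (r j) u0 F G) cov_cmean2 // [leLHS]mulrDr [leRHS]mulrDl; apply: lerD.
Qed.

(** Each step moves one color from [J] to [K], so the induction runs over all [K]. *)
Lemma expands_card I c : 0 <= c ->
  (forall K j, j \notin K -> j \notin I -> [disjoint K & I] -> expands K I [set j] c) ->
  forall J K, J != set0 -> [disjoint K & I] -> [disjoint K & J] -> [disjoint I & J] ->
    expands K I J (#|J|%:R * c).
Proof.
move=> c0 base J; elim: {J}#|J| {-2}J (erefl #|J|) => [|n IH] J cJ K J0 KI KJ IJ.
  by rewrite (cards0_eq cJ) eqxx in J0.
have [j jJ] := set0Pn _ J0.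
have jK : j \notin K by rewrite (disjointFl KJ).
have jI : j \notin I by rewrite (disjointFl IJ).
have bj : expands K I [set j] c by apply: base.
have cJ' : #|J :\ j| = n by move: cJ; rewrite (cardsD1 j) jJ => -[].
have [J1|J1] := eqVneq (J :\ j) set0.
  have n0 : n = 0%N by rewrite -cJ' J1 cards0.
  by rewrite cJ n0 mul1r -(setD1K jJ) J1 setU0.
rewrite cJ -(setD1K jJ) -natr1 mulrDl mul1r; apply: expands_add => //.
  by rewrite mulr_ge0.
rewrite -cJ'; apply: IH => //.
- by rewrite -setI_eq0 setIUl setU_eq0 !setI_eq0 disjoints1 jI.
- rewrite -setI_eq0 setIUl setU_eq0 !setI_eq0 disjoints1 !inE eqxx /=.
  by apply: disjointWr KJ; apply: subsetDl.
- by apply: disjointWr IJ; apply: subsetDl.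
Qed.

Lemma expands_trickle K i j k eta gam : 0 <= gam -> gam <= 1 -> 0 < eta ->
  expands (k |: K) [set i] [set j] gam ->
  expands K [set i] [set k] eta -> expands K [set j] [set k] eta ->
  expands K [set i] [set j] (gam + (1 - gam) * eta ^+ 2).
Proof.
move=> g0 g1 e0 eij eik ejk t0 F G dF dG.
set u := pinned K t0; have u0 : forall t, 0 <= u t by move=> t; apply: pinned_ge0.
(* Testing against the conditional mean scaled by [eta^-1] recovers the Cauchy-Schwarz form from the
   additive form of [expands]. *)
have mean_le l H : expands K [set l] [set k] eta -> depends_on (K :|: [set l]) H ->
    cov u (cmean (r k) u H) (cmean (r k) u H) <= eta ^+ 2 * cov u H H.
  move=> el dH.
  have := el t0 H (fun t => eta^-1 * cmean (r k) u H t) dH.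
  rewrite -/u !covZr [cov u (fun t => _ * _) _]covC covZr -cov_cmean2 //.
  set m := cov u (cmean _ _ _) _ => h.
  have {}h : 2 * (eta^-1 * m) <= eta * (cov u H H + eta^-1 * (eta^-1 * m)).
    apply: h => t t' a; congr (_ * _).
    by apply: (@depends_cmean (K :|: [set k]) k) a; rewrite in_setU set11 orbT.
  have {}h : eta * (2 * (eta^-1 * m)) <= eta * (eta * (cov u H H + eta^-1 * (eta^-1 * m))).
    by rewrite ler_pM2l.
  move: h; have -> : eta * (2 * (eta^-1 * m)) = 2 * m by field; rewrite gt_eqF.
  have -> : eta * (eta * (cov u H H + eta^-1 * (eta^-1 * m))) = eta ^+ 2 * cov u H H + m.
    by field; rewrite gt_eqF.
  by lra.
have mF := mean_le i F eik dF; have mG := mean_le j G ejk dG.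
have cm := cov_le_var u0 (cmean (r k) u F) (cmean (r k) u G).
have le1 : 2 * \sum_x cov (cnd (r k) u x) F G <=
    gam * (\sum_x cov (cnd (r k) u x) F F + \sum_x cov (cnd (r k) u x) G G).
  rewrite -big_split !mulr_sumr /=; apply: ler_sum => x _.
  by apply: (cov_cnd_le eij); apply: depends_sub (dF) || apply: depends_sub (dG);
     rewrite setSU // subsetUr.
rewrite (total_cov (r k) u0 F G).
move: mF mG cm le1 (total_var (r k) u0 F) (total_var (r k) u0 G).
set mFF := cov u (cmean _ _ F) (cmean _ _ F); set mGG := cov u (cmean _ _ G) (cmean _ _ G).
set mFG := cov u (cmean _ _ F) _.
set sFF := \sum_x cov _ F F; set sGG := \sum_x cov _ G G; set sFG := \sum_x cov _ F G.
move=> mF mG cm le1 vF vG.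
(* The variance inside the fibres is the total minus that of the means, so the means enter with the
   factor [1 - gam]. *)
have : (1 - gam) * (mFF + mGG) <= (1 - gam) * (eta ^+ 2 * (cov u F F + cov u G G)).
  by apply: ler_wpM2l; lra.
by rewrite vF vG; lra.
Qed.

End Coordinates.

(** * Trickling down *)

Section Recursion.
Variable R : rcfType.
Implicit Types (x eta gam delta : R).

Lemma geometric_le_inv x N : 0 <= x -> x <= 1 -> (1 - x) ^+ N * (1 + N%:R * x) <= 1.
Proof.
move=> x0 x1; elim: N => [|N IH]; first by rewrite expr0 mul0r addr0 mulr1.
apply: le_trans IH; rewrite exprSr -mulrA ler_wpM2l ?exprn_ge0 ?subr_ge0 //.
rewrite -natr1; have N0 : 0 <= N%:R :> R by [].
by nra.
Qed.

(** The rate and the target are given by natural numbers because [R] need not be archimedean: powers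
    of an arbitrary number below 1 need not become small. *)
Lemma geometric_small (K p q : nat) : (0 < p)%N -> (0 < q)%N ->
  exists N, K%:R * (1 - q%:R^-1) ^+ N <= p%:R^-1 :> R.
Proof.
move=> p0 q0; exists (q * (K * p))%N.
have pR : 0 < p%:R :> R by rewrite ltr0n.
have qR : 1 <= q%:R :> R by rewrite ler1n.
have q1 : q%:R^-1 <= 1 :> R by rewrite invf_le1 // (lt_le_trans ltr01).
have qi : 0 <= q%:R^-1 :> R by rewrite invr_ge0.
have := geometric_le_inv (q * (K * p)) qi q1.
set rho := (1 - _) ^+ _ => h.
have rho0 : 0 <= rho by rewrite exprn_ge0 ?subr_ge0.
rewrite -(ler_pM2r pR) mulVf ?gt_eqF // mulrAC -natrM mulrC.
apply: le_trans h; rewrite ler_wpM2l // [(q * _)%:R]natrM mulrAC mulfV ?mul1r ?lerDr ?ler01 //.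
by rewrite gt_eqF // (lt_le_trans ltr01).
Qed.

(** The map [x -> gam + (1 - gam) * x ^+ 2] fixes [s = gam / (1 - gam)] and 1; started below 1, it
    contracts towards [s]. The bound [eta <= 1 - 1/q] keeps the rate at most [1 - 1/(2q)]. The error
    is measured in units of [gam ^+ 2], so the number of steps depends on [n], [p], [q] only, even
    for infinitesimal [gam]. *)
Lemma trickle_limit (Q : R -> Prop) gam eta (n p q : nat) :
  (forall x y, x <= y -> Q x -> Q y) ->
  (forall x, 0 < x -> Q x -> Q (gam + (1 - gam) * x ^+ 2)) ->
  0 < gam -> gam <= 1 / 2 -> (0 < p)%N -> (0 < q)%N ->
  Q eta -> eta <= n%:R * gam -> eta <= 1 - q%:R^-1 ->
  Q (gam / (1 - gam) + p%:R^-1 * gam ^+ 2).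
Proof.
move=> Qle Qstep g0 g2 p0 q0 Qeta etan etaq.
pose s := gam / (1 - gam).
have sE : (1 - gam) * s = gam by rewrite /s; field; apply/eqP; lra.
have s0 : 0 < s by rewrite divr_gt0 //; lra.
have pR : 0 < p%:R^-1 :> R by rewrite invr_gt0 ltr0n.
have qR : 0 < q%:R^-1 :> R by rewrite invr_gt0 ltr0n.
have nR : 0 <= n%:R :> R by [].
have [etas|etas] := leP eta s.
  by apply: Qle Qeta; apply: le_trans etas _; rewrite lerDl mulr_ge0 ?sqr_ge0 // ltW.
have step x : gam + (1 - gam) * x ^+ 2 - s = (x - s) * ((1 - gam) * x + gam).
  have xs : x * ((1 - gam) * s) = x * gam by rewrite sE.
  by lra.
(* Bounds the error after one step: [eta - s <= n gam] times the rate
   [(1 - gam) eta + gam <= (n + 1) gam]. Hence [inv] starts from the first iterate and not from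
   [eta]. *)
pose z := (n * n.+1)%:R * gam ^+ 2.
pose rho : R := 1 - (2 * q)%:R^-1.
have rate0 x : s <= x -> 0 <= (1 - gam) * x + gam.
  by move=> sx; rewrite addr_ge0 ?mulr_ge0 ?(ltW g0) //; lra.
have rate1 x : x <= 1 - q%:R^-1 -> (1 - gam) * x + gam <= rho.
  have -> : rho = 1 - q%:R^-1 / 2 by rewrite /rho natrM invfM mulrC.
  move=> xq; have : (1 - gam) * x <= (1 - gam) * (1 - q%:R^-1) by apply: ler_wpM2l; lra.
  have : 0 <= (1 / 2 - gam) * q%:R^-1 by rewrite mulr_ge0 ?(ltW qR) //; lra.
  by lra.
have desc x : s <= x -> x <= 1 - q%:R^-1 -> gam + (1 - gam) * x ^+ 2 <= 1 - q%:R^-1.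
  move=> sx xq; apply: le_trans (xq); rewrite -(lerD2r (- s)) step -[leRHS]mulr1.
  apply: ler_wpM2l; first by lra.
  have := rate1 x xq; have : 0 <= (2 * q)%:R^-1 :> R by rewrite invr_ge0. rewrite /rho; lra.
have inv N : exists x, [/\ Q x, s <= x, x <= 1 - q%:R^-1 & x - s <= z * rho ^+ N].
  elim: N => [|N [x [Qx sx xq xz]]].
    exists (gam + (1 - gam) * eta ^+ 2); have se := ltW etas; split.
    - by apply: Qstep => //; lra.
    - by rewrite -subr_ge0 step mulr_ge0 ?rate0 // subr_ge0.
    - exact: desc.
    - rewrite step expr0 mulr1 /z natrM -natr1.
      have -> : n%:R * (n%:R + 1) * gam ^+ 2 = (n%:R * gam) * ((n%:R + 1) * gam) by ring.
      apply: ler_pM; [lra|exact: rate0|lra|].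
      have : 0 <= gam * eta by rewrite mulr_ge0 //; lra.
      by lra.
  exists (gam + (1 - gam) * x ^+ 2); split.
  - by apply: Qstep => //; lra.
  - by rewrite -subr_ge0 step mulr_ge0 ?rate0 // subr_ge0.
  - exact: desc.
  - by rewrite step exprSr mulrA; apply: ler_pM => //; [lra|exact: rate0|exact: rate1].
have [N hN] := geometric_small (n * n.+1) p0 (isT : (0 < 2 * q.-1.+1)%N).
have [x [Qx sx xq xz]] := inv N.
apply: Qle Qx; rewrite -lerBlDl; apply: le_trans xz _.
rewrite prednK // in hN.
rewrite /z mulrAC ler_wpM2r ?sqr_ge0 //.
Qed.
End Recursion.

Section Levels.
Variables (R : rcfType) (T C A : finType) (r : C -> T -> A) (w : T -> R).
Hypothesis w0 : forall t, 0 <= w t.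
Variables (d : nat) (lam : R).
Hypotheses (cardC : #|C| = d.+1) (lam0 : 0 < lam) (lam2 : lam < 1 / 2).
Let mu : R := lam / (d.+1%:R * lam + 1).
Hypothesis base : forall (K : {set C}) i j, (#|K| < d)%N ->
  i \notin K -> j \notin K -> i != j ->
  expands r w K [set i] [set j] ((d - #|K|)%:R * mu).

(* The exact fixed point would allow the step [a -> a - 1]; the extra [1/d]
   gives the slack that makes finitely many iterations of [expands_trickle]
   suffice, and is affordable because only [d - 1] steps are taken. *)
Let inv_bound (m : nat) : R := d.+1%:R + lam^-1 - (1 + d%:R^-1) * m%:R.

(** At most [d - 1] steps cost a total slack of at most 1. This keeps the bounds below [lam] at all
    levels. *)
Lemma inv_bound_gt m : (m < d)%N -> 1 + lam^-1 <= inv_bound m.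
Proof.
move=> md; have d0 : 0 < d%:R :> R by rewrite ltr0n (leq_ltn_trans _ md).
have h : m%:R + 1 <= d%:R :> R by rewrite natr1 ler_nat.
have : d%:R^-1 * m%:R <= 1 :> R by rewrite mulrC ler_pdivrMr //; lra.
by rewrite /inv_bound -natr1; lra.
Qed.

(** Induction on [m], the link of [K] having [m + 2] free colors. For [m = 0] it is the base bound,
    as [mu] is the inverse of [inv_bound 0]. Beyond that, the links with one more frozen color have
    the bound [1 / a], and trickling down yields about [1 / (a - 1)]. *)
Lemma expands_pair m (K : {set C}) i j : (#|K| + m.+1)%N = d ->
  i \notin K -> j \notin K -> i != j ->
  expands r w K [set i] [set j] (inv_bound m)^-1.
Proof.
have li0 : 0 < lam^-1 by rewrite invr_gt0.
have l2 : lam * 2 < 1 by have l2 : lam < 1 / 2 := lam2; lra.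
have li2 : 2 < lam^-1 by rewrite -(ltr_pM2l lam0) mulfV ?gt_eqF.
have muE : mu = (inv_bound 0)^-1.
  rewrite /mu /inv_bound mulr0 subr0; field; rewrite !gt_eqF //=.
  by rewrite ltr_wpDl // mulr_ge0 // ?addr_ge0 // ltW.
elim: m K i j => [|m IH] K i j Km iK jK ij.
  by rewrite -muE -[mu]mul1r; have := base _ iK jK ij; rewrite -Km addn1 subSn // subnn; apply.
have md : (m.+1 < d)%N by rewrite -Km addnS ltnS leq_addl.
have d0 : (0 < d)%N by apply: leq_ltn_trans md.
have dR : 0 < d%:R :> R by rewrite ltr0n.
have dI : 0 < d%:R^-1 :> R by rewrite invr_gt0.
have am := inv_bound_gt (ltnW md); have am1 := inv_bound_gt md.
have aS : inv_bound m.+1 = inv_bound m - 1 - d%:R^-1.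
  by rewrite /inv_bound -[m.+1%:R]natr1; ring.
set a := inv_bound m in am aS IH.
have a0 : 0 < a by lra.
have a2 : a^-1 <= 1 / 2 by rewrite div1r lef_pV2 ?posrE //; lra.
have KD : (#|K| < d)%N by rewrite -Km addnS ltnS leq_addr.
(* All pairs at once, since improving the pair [i], [j] uses the pairs [i], [k] and [j], [k]. *)
pose Q eta := forall i j, i \notin K -> j \notin K -> i != j ->
  expands r w K [set i] [set j] eta.
have mu0 : 0 < mu by rewrite muE invr_gt0 (lt_le_trans _ (inv_bound_gt d0)) //; lra.
have dmu : (d - #|K|)%:R * mu <= d%:R * mu by rewrite ler_wpM2r ?ler_nat ?leq_subr // ltW.
have : Q (a^-1 / (1 - a^-1) + d%:R^-1 * a^-1 ^+ 2).
  (* The start is the base bound, at most [d mu]; this is at most [d / a], and at most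
     [1 - 1/(d + 1)] because [mu <= 1/(d + 1)]. *)
  apply: (@trickle_limit R Q _ ((d - #|K|)%:R * mu) d d d.+1) => //.
  - by move=> x y xy Qx i' j' iK' jK' ij'; apply: expands_le xy _ => //; apply: Qx.
  - move=> x x0 Qx i' j' iK' jK' ij'.
    have [k] : exists k, k \notin i' |: (j' |: K).
      apply/existsP; rewrite -negb_forall; apply: contraTN md => /forallP full.
      have : #|C| = #|i' |: (j' |: K)| by rewrite -cardsT; apply: eq_card => k; rewrite inE full.
      rewrite cardC cardsU1 cardsU1 !inE (negPf iK') (negPf jK') (negPf ij') /=.
      by rewrite !add1n -{1}Km !addnS => -[/eqP]; rewrite gtn_eqF // ltnS leq_addr.
    rewrite !inE !negb_or => /and3P [ki kj kK].
    apply: (expands_trickle w0 (k := k)) => //; rewrite ?invr_ge0 ?(ltW a0) //; first by lra.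
    + apply: IH; rewrite ?inE ?negb_or ?iK' ?jK' ?(eq_sym _ k) ?ki ?kj //.
      by rewrite cardsU1 kK -Km !addnS add1n addSn.
    + by apply: Qx => //; rewrite eq_sym.
    + by apply: Qx => //; rewrite eq_sym.
  - by rewrite invr_gt0.
  - by move=> i' j' iK' jK' ij'; apply: base.
  - apply: le_trans dmu _; rewrite ler_wpM2l // muE lef_pV2 ?posrE //.
      rewrite /a /inv_bound mulr0 lerD2l lerN2 mulr_ge0 //; lra.
    by apply: lt_le_trans (inv_bound_gt d0); lra.
  - apply: le_trans dmu _; rewrite muE /inv_bound mulr0 subr0 -natr1.
    have -> : 1 - (d%:R + 1)^-1 = d%:R / (d%:R + 1) :> R by field; apply/eqP; lra.
    by rewrite ler_wpM2l // lef_pV2 ?posrE; lra.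
move=> /(_ i j iK jK ij); apply: expands_le => //.
(* The bound reached is [1 / (a - 1) + e / a ^+ 2]. Passing from [1 / (a - 1)] to [1 / (a - 1 - e)]
   gains [e / ((a - 1) (a - 1 - e))], which absorbs the error. *)
rewrite aS; set e := d%:R^-1 in dI aS *.
have b0 : 0 < a - 1 - e by lra.
rewrite -subr_ge0.
have -> : (a - 1 - e)^-1 - (a^-1 / (1 - a^-1) + e * a^-1 ^+ 2) =
   e * (a ^+ 2 - (a - 1) * (a - 1 - e)) / ((a - 1 - e) * (a - 1) * a ^+ 2).
  by field; rewrite !gt_eqF //; lra.
by rewrite divr_ge0 ?mulr_ge0 ?sqr_ge0 //; nra.
Qed.

(** With [lam] valid for single colors in every link, [expands_card] is applied first to [J] against
    one color, then, by symmetry, to [I]. *)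
Lemma expands_colors (I J : {set C}) : I != set0 -> J != set0 -> [disjoint I & J] ->
  expands r w set0 I J ((#|I| * #|J|)%:R * lam).
Proof.
move=> I0 J0 IJ.
have pair (K : {set C}) i j : i \notin K -> j \notin K -> i != j ->
    expands r w K [set i] [set j] lam.
  move=> iK jK ij.
  have KD : (#|K| < d)%N.
    have /subset_leq_card : [set i; j] \subset ~: K.
      by apply/subsetP => k; rewrite !inE => /orP [] /eqP ->.
    by rewrite cards2 ij -(leq_add2l #|K|) cardsC cardC addn2.
  have Km : (#|K| + (d - #|K|).-1.+1)%N = d.
    by rewrite prednK ?subn_gt0 // subnKC // ltnW.
  apply: expands_le (expands_pair Km iK jK ij) => //.
  have md : ((d - #|K|).-1 < d)%N by rewrite -[X in (_ < X)%N]Km leq_addl.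
  have li0 : 0 < lam^-1 by rewrite invr_gt0.
  have := inv_bound_gt md => h.
  by rewrite -[leRHS]invrK lef_pV2 ?posrE //; lra.
have sets (K : {set C}) i (J' : {set C}) : J' != set0 -> [disjoint K & J'] -> i \notin K ->
    i \notin J' -> expands r w K [set i] J' (#|J'|%:R * lam).
  move=> J'0 KJ iK iJ; apply: (expands_card w0 (ltW lam0)) => //; last 2 first.
  - by rewrite disjoint_sym disjoints1.
  - by rewrite disjoints1.
  by move=> K' j jK; rewrite inE eq_sym disjoint_sym disjoints1 => ij iK'; apply: pair.
rewrite natrM -mulrA; apply: expands_sym.
apply: (expands_card w0) => //; first by rewrite mulr_ge0 // ltW.
- by move=> K i iK iJ KJ; apply: expands_sym; apply: sets.
- by rewrite disjoints_subset sub0set.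
- by rewrite disjoints_subset sub0set.
- by rewrite disjoint_sym.
Qed.
End Levels.

(** * Links of partite complexes *)

Lemma cov_centered (R : rcfType) (T : finType) (u F G : T -> R) :
  expect u (fun=> 1) != 0 ->
  let c H t := H t - expect u H / expect u (fun=> 1) in
  cov u F G = expect u (fun t => c F t * c G t).
Proof.
move=> W0 /=; set W := expect u _ in W0 *.
rewrite /cov -/W; set a := expect u F; set b := expect u G.
have -> : expect u (fun t => (F t - a / W) * (G t - b / W)) =
    expect u (fun t => (F t * G t + (- (b / W)) * F t) + (- (a / W)) * (G t + (- (b / W)) * 1)).
  by apply: eq_bigr => t _; ring.
by rewrite !expectD -/a -/b -/W; field.
Qed.

(** Conjugating the walk by the square roots of [p] gives a symmetric matrix that fixes the vector
    of these roots. The Rayleigh bound is then applied to [h] times that vector. *)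
Lemma walk_poincare (R : rcfType) (V : finType) (X : {set V}) (p : V -> R)
    (q : V -> V -> R) (m mu : R) (h : V -> R) :
  (forall v, v \in X -> 0 < p v) -> (forall v u, q v u = q u v) -> 0 < m ->
  (forall v, v \in X -> \sum_(u in X | u != v) q v u = m * p v) ->
  second_eig_le (\matrix_(i < #|X|, j < #|X|)
    if enum_val j != enum_val i then
      q (enum_val i) (enum_val j) / (m * p (enum_val i)) else 0) mu ->
  mu < 1 -> \sum_(v in X) p v * h v = 0 ->
  \sum_(v in X) \sum_(u in X | u != v) q v u * (h v * h u) <=
    m * mu * \sum_(v in X) p v * h v ^+ 2.
Proof.
move=> p0 qC m0 rows; set M := \matrix_(_, _) _ => eigM mu1 h0.
have [->|X0] := eqVneq X set0; first by rewrite !big_set0 mulr0.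
pose n := #|X|; pose e (i : 'I_n) : V := enum_val i.
have eX i : e i \in X by apply: enum_valP.
have ep i : 0 < p (e i) by apply: p0.
pose sp i := Num.sqrt (p (e i)).
have sp0 i : sp i != 0 by rewrite gt_eqF // sqrtr_gt0.
have spE i : p (e i) = sp i ^+ 2 by rewrite sqr_sqrtr // ltW.
pose S : 'M[R]_n := \matrix_(i, j)
  if e j != e i then q (e i) (e j) / (m * (sp i * sp j)) else 0.
pose D : 'rV[R]_n := \row_i sp i.
have eigS : second_eig_le S mu.
  case: eigM => rs [rE rc]; exists rs; split => //; rewrite -rE.
  apply: (@char_poly_intertwine _ _ _ _ (diag_mx D)).
    rewrite unitmxE det_diag unitfE; apply/prodf_neq0 => i _.
    by rewrite mxE.
  apply/matrixP => i j; rewrite mul_mx_diag mul_diag_mx !mxE -!/(e _) spE.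
  case: ifP => _; last by rewrite mul0r mulr0.
  by field; rewrite !sp0 gt_eqF.
have symS : S^T = S.
  apply/matrixP => i j; rewrite !mxE eq_sym qC [sp j * _]mulrC.
  by case: ifP.
have sumX (F : V -> R) : \sum_(v in X) F v = \sum_i F (e i) by rewrite big_enum_val.
have sumX2 (F : V -> V -> R) v : \sum_(u in X | u != v) F v u =
    \sum_i if e i != v then F v (e i) else 0.
  by rewrite big_mkcondr /= sumX.
have fixD : D *m S = D.
  apply/rowP => j; rewrite mxE [RHS]mxE.
  transitivity (\sum_i (if e i != e j then q (e j) (e i) else 0) / (m * sp j)).
    apply: eq_bigr => i _; rewrite !mxE eq_sym qC.
    by case: ifP => _; rewrite ?mulr0 ?mul0r //; field; rewrite !sp0 gt_eqF.
  rewrite -mulr_suml -sumX2 rows // spE; by field; rewrite sp0 gt_eqF.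
have D0 : D != 0.
  have [v vX] := set0Pn _ X0.
  apply/eqP => /rowP /(_ (enum_rank_in vX v)); rewrite !mxE => /eqP.
  by rewrite (negPf (sp0 _)).
pose x : 'rV[R]_n := \row_i (sp i * h (e i)).
have xD : x *m D^T = 0.
  apply/rowP => j; rewrite !mxE -[RHS]h0 sumX; apply: eq_bigr => i _.
  by rewrite !mxE spE; ring.
have := rayleigh_second_eig symS eigS mu1 fixD D0 xD.
have -> : (x *m x^T) 0 0 = \sum_(v in X) p v * h v ^+ 2.
  by rewrite mxE sumX; apply: eq_bigr => i _; rewrite !mxE spE; ring.
have -> : (x *m S *m x^T) 0 0 =
    m^-1 * \sum_(v in X) \sum_(u in X | u != v) q v u * (h v * h u).
  rewrite mxE mulr_sumr sumX.
  rewrite (eq_bigr (fun j => \sum_i x 0 i * S i j * x 0 j)); last first.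
    by move=> j _; rewrite !mxE mulr_suml; apply: eq_bigr => i _; rewrite !mxE.
  rewrite exchange_big; apply: eq_bigr => i _ /=.
  rewrite (sumX2 (fun v u => q v u * (h v * h u))) mulr_sumr; apply: eq_bigr => j _.
  rewrite !mxE; case: ifP => _; last by ring.
  by field; rewrite !sp0 gt_eqF.
by rewrite ler_pdivrMl // mulrA.
Qed.

Section Complex.
Variables (R : rcfType) (V : finType) (d : nat) (w : {set V} -> R).
Variable (col : V -> 'I_d.+1).
Hypotheses (wP : is_weighted_complex d w) (colP : is_partite w col).
Implicit Types (s t : {set V}) (I J K : {set 'I_d.+1}).

Let w0 t : 0 <= w t. Proof. by case: wP. Qed.

Definition cells (i : 'I_d.+1) t := [set v in t | col v == i].

Definition restr K t := [set v in t | col v \in K].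

Lemma restr_agree K t t' : agree cells K t t' -> restr K t = restr K t'.
Proof.
move=> /agreeP a; apply/setP => v; rewrite !inE.
have [cK|] := boolP (col v \in K); rewrite ?andbF ?andbT //.
by have /setP /(_ v) := a _ cK; rewrite !inE eqxx !andbT.
Qed.

Lemma agree_restr K t t' : restr K t = restr K t' -> agree cells K t t'.
Proof.
move=> /setP e; apply/agreeP => i iK; apply/setP => v; have := e v.
by rewrite !inE; case: eqP => [->|]; rewrite ?andbF ?iK ?andbT.
Qed.

Lemma col_ex t i : 0 < w t -> exists2 v, v \in t & col v = i.
Proof.
move=> wt; have /eqP/cards1P [v /setP /(_ v)] := colP wt i.
by rewrite !inE eqxx => /andP [vt /eqP cv]; exists v.
Qed.

Lemma col_inj t : 0 < w t -> {in t &, injective col}.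
Proof.
move=> wt v v' vt vt' e; have /eqP/cards1P [x /setP xE] := colP wt (col v).
have := xE v; have := xE v'; rewrite !inE vt vt' e eqxx.
by move=> /esym/eqP -> /esym/eqP ->.
Qed.

Lemma Wt_gt0 s t : 0 < w t -> s \subset t -> 0 < Wt w s.
Proof.
move=> wt st; rewrite /Wt (bigD1 t) //= ltr_pwDl //.
by apply: sumr_ge0 => t' _.
Qed.

Lemma col_restr K t : 0 < w t -> col @: restr K t = K.
Proof.
move=> wt; apply/setP => i; apply/imsetP/idP => [[v]|iK].
  by rewrite inE => /andP [_ vK] ->.
by have [v vt cv] := col_ex i wt; exists v; rewrite ?inE ?vt ?cv.
Qed.

Lemma restr_sub K t : restr K t \subset t.
Proof. by apply/subsetP => v; rewrite inE => /andP []. Qed.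

Lemma restrP K t s : 0 < w t ->
  (col @: s == K) && (s \subset t) = (s == restr K t).
Proof.
move=> wt; apply/andP/eqP => [[/eqP cs st]|->]; last first.
  by rewrite col_restr ?restr_sub.
apply/setP => v; rewrite inE; apply/idP/andP => [vs|[vt]].
  by rewrite (subsetP st) // -cs imset_f.
rewrite -cs => /imsetP [v' vs' e].
by rewrite (col_inj wt vt (subsetP st _ vs') e).
Qed.

Lemma colface_restrP K t s : 0 < w t ->
  colface w col K s && (s \subset t) = (s == restr K t).
Proof.
move=> wt; rewrite -restrP // /colface /is_face.
have [st|] := boolP (s \subset t); rewrite ?andbF ?andbT //.
by rewrite (Wt_gt0 wt st).
Qed.

Lemma wN0 t : w t != 0 -> 0 < w t.
Proof. by rewrite lt0r w0 andbT. Qed.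

(** A top face of positive weight contains exactly one face of color set [K]. *)
Lemma sum_colface K (phi : {set V} -> R) :
  \sum_(s : {set V} | colface w col K s) Wt w s * phi s =
  expect w (fun t => phi (restr K t)).
Proof.
rewrite /Wt (eq_bigr (fun s => \sum_(t : {set V}) if s \subset t then w t * phi s else 0)); last first.
  by move=> s _; rewrite mulr_suml big_mkcond.
rewrite exchange_big; apply: eq_bigr => t _ /=.
have [->|/wN0 wt] := eqVneq (w t) 0.
  by rewrite big1 ?mul0r // => s _; case: ifP; rewrite ?mul0r.
rewrite -big_mkcondr /= (eq_bigl (fun s => s == restr K t)) ?big_pred1_eq //.
by move=> s; apply: colface_restrP.
Qed.

Lemma meas_colE K s : colface w col K s -> meas_col w col K s = Wt w s.
Proof.
rewrite /meas_col => ->; have [_ [w1 _]] := wP.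
have := sum_colface K (fun=> 1).
under eq_bigr do rewrite mulr1.
move=> ->; rewrite /expect (eq_bigr w) => [|t _]; last by rewrite mulr1.
by rewrite w1 divr1.
Qed.

Lemma ip_colE K (f g : {set V} -> R) :
  ip_col w col K f g = expect w (fun t => f (restr K t) * g (restr K t)).
Proof.
rewrite -(sum_colface K (fun s => f s * g s)).
by apply: eq_bigr => s cs; rewrite meas_colE // mulrA.
Qed.

Lemma restrU I J t : restr (I :|: J) t = restr I t :|: restr J t.
Proof. by apply/setP => v; rewrite !inE andb_orr. Qed.

Lemma col_edgeE I J s t t' : [disjoint I & J] -> 0 < w t' -> colface w col I s ->
  col_edge w col I J s t && (s :|: t \subset t') = (s \subset t') && (t == restr J t').
Proof.
move=> IJ wt cs; rewrite /col_edge cs /= subUset.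
apply/idP/idP.
  case/andP => /and3P [ct _ _] /andP [-> tt] /=.
  by rewrite -colface_restrP // ct.
case/andP => st /eqP ->.
have /eqP sE : s == restr I t' by rewrite -colface_restrP // cs.
have ct : colface w col J (restr J t') && (restr J t' \subset t') by rewrite colface_restrP.
have cst : colface w col (I :|: J) (restr (I :|: J) t') && (restr (I :|: J) t' \subset t').
  by rewrite colface_restrP.
case/andP: ct => -> ->; rewrite st sE -restrU; case/andP: cst => -> _; rewrite !andbT /=.
rewrite -setI_eq0; apply/eqP/setP => v; rewrite !inE; apply/negP => /andP [/andP [_ vI] /andP [_ vJ]].
by have := disjointFr IJ vI; rewrite vJ.
Qed.

Lemma sum_col_edge I J s (phi : {set V} -> R) : [disjoint I & J] -> colface w col I s ->
  \sum_(t : {set V} | col_edge w col I J s t)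
      meas_col w col (I :|: J) (s :|: t) * phi t =
  \sum_(t : {set V} | s \subset t) w t * phi (restr J t).
Proof.
move=> IJ cs.
rewrite (eq_bigr (fun t => \sum_(t' : {set V}) if s :|: t \subset t' then w t' * phi t else 0)); last first.
  move=> t /and4P [_ _ _ cst]; rewrite meas_colE // /Wt mulr_suml big_mkcond.
  by apply: eq_bigr.
rewrite exchange_big [RHS]big_mkcond; apply: eq_bigr => t' _ /=.
have [->|/wN0 wt] := eqVneq (w t') 0.
  by rewrite mul0r if_same big1 // => t _; rewrite mul0r if_same.
rewrite -big_mkcondr /= (eq_bigl (fun t => (s \subset t') && (t == restr J t'))).
  by case: (s \subset t'); rewrite ?big_pred0_eq ?big_pred1_eq.
by move=> t; apply: col_edgeE.
Qed.

(** The denominator of the walk at [s] is [Wt w s], which cancels the measure of [s]. *)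
Lemma ip_colwalkE I J (f g : {set V} -> R) : [disjoint I & J] ->
  ip_col w col I (colwalk_op w col I J f) g =
  expect w (fun t => f (restr J t) * g (restr I t)).
Proof.
move=> IJ.
transitivity (\sum_(s : {set V} | colface w col I s)
    \sum_(t : {set V}) if s \subset t then w t * f (restr J t) * g s else 0).
  apply: eq_bigr => s cs; rewrite meas_colE // /colwalk_op.
  have := sum_col_edge (fun=> 1) IJ cs; under eq_bigr do rewrite mulr1; move=> ->.
  rewrite sum_col_edge // -[RHS]big_mkcond -[RHS]mulr_suml; congr (_ * _).
  under [X in _ / X]eq_bigr do rewrite mulr1.
  have /andP [fs _] := cs; rewrite -/(Wt w s) mulrC divfK //.
  by rewrite gt_eqF.
rewrite exchange_big; apply: eq_bigr => t _ /=.
have [->|/wN0 wt] := eqVneq (w t) 0.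
  by rewrite big1 ?mul0r // => s _; rewrite !mul0r if_same.
rewrite -big_mkcondr /= (eq_bigl (fun s => s == restr I t)).
  by rewrite big_pred1_eq mulrA.
by move=> s; apply: colface_restrP.
Qed.

(** Expanding the square, the diagonal gives the 1 and the off-diagonal terms are the quadratic form
    of the link walk. *)
Lemma link_second_moment s (mu : R) (h : V -> R) :
  one_sided_link_expander d w mu -> mu < 1 -> is_face w s -> (#|s| < d)%N ->
  let u t := if s \subset t then w t else 0 in
  let sum_link (f : V -> R) t := \sum_(v in link_vert w s) (v \in t)%:R * f v in
  expect u (sum_link h) = 0 ->
  expect u (fun t => sum_link h t ^+ 2) <=
    (1 + (d - #|s|)%:R * mu) * expect u (sum_link (fun v => h v ^+ 2)).
Proof.
move=> expd mu1 fs sd /=; set X := link_vert w s; set u := fun t => _.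
pose p v := Wt w (v |: s); pose q v v' := Wt w (v' |: (v |: s)).
have sub1 v t : (v |: s \subset t) = (s \subset t) && (v \in t).
  by rewrite subUset sub1set andbC.
have ex1 (f : V -> R) :
    expect u (fun t => \sum_(v in X) (v \in t)%:R * f v) = \sum_(v in X) p v * f v.
  rewrite /expect; under eq_bigr do rewrite mulr_sumr.
  rewrite exchange_big; apply: eq_bigr => v _ /=.
  rewrite /p /Wt [X in X * f v]big_mkcond mulr_suml; apply: eq_bigr => t _.
  rewrite sub1 /u; case: (s \subset t); case: (v \in t) => /=; ring.
rewrite !ex1 => h0.
have qC v v' : q v v' = q v' v by rewrite /q setUCA.
have q1 v : q v v = p v by rewrite /q setUA setUid.
have p0 v : v \in X -> 0 < p v by rewrite inE => /andP [].
have m0 : 0 < (d - #|s|)%:R :> R by rewrite ltr0n subn_gt0.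
(* A top face of [d + 1] vertices containing [v |: s] has [d - #|s|] further vertices, all in the
   link. *)
have rows v : v \in X -> \sum_(v' in X | v' != v) q v v' = (d - #|s|)%:R * p v.
  move=> vX; have vs : v \notin s by move: vX; rewrite inE => /andP [].
  rewrite /q /p /Wt mulr_sumr [RHS]big_mkcond.
  rewrite (eq_bigr (fun v' => \sum_(t : {set V})
    if v' |: (v |: s) \subset t then w t else 0)); last first.
    by move=> v' _; rewrite big_mkcond.
  rewrite exchange_big; apply: eq_bigr => t _ /=.
  have [->|/wN0 wt] := eqVneq (w t) 0.
    by rewrite mulr0 if_same big1 // => v' _; rewrite if_same.
  have [st|st] := boolP (v |: s \subset t); last first.
    by rewrite big1 // => v' _; rewrite subUset (negPf st) andbF.
  rewrite -big_mkcondr /= sumr_const mulr_natl; congr (_ *+ _).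
  transitivity #|t :\: (v |: s)|.
    apply: eq_card => v'; rewrite !inE !negb_or unfold_in /= subUset sub1set st andbT.
    have [v't|] := boolP (v' \in t); rewrite ?andbF ?andbT //=.
    rewrite andbC [v' \in X]inE; congr (_ && _); case: (v' \in s) => //=.
    rewrite (_ : 0 < _ = true) ?andbT //; apply: (Wt_gt0 wt).
    by move: st; rewrite !subUset !sub1set v't => /andP [].
  by rewrite cardsD (setIidPr st) cardsU1 vs; case: wP => _ [_ /(_ t wt) ->].
have eigM : second_eig_le (\matrix_(i < #|X|, j < #|X|)
    if enum_val j != enum_val i then q (enum_val i) (enum_val j) /
      ((d - #|s|)%:R * p (enum_val i)) else 0) mu.
  have := expd s fs sd; congr (second_eig_le _ _); apply/matrixP => i j.
  rewrite !mxE /link_walk enum_valP andbT; case: ifP => // _.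
  by rewrite -(rows _ (enum_valP i)).
have poinc := walk_poincare p0 qC m0 rows eigM mu1 h0.
have -> : expect u (fun t => (\sum_(v in X) (v \in t)%:R * h v) ^+ 2) =
    \sum_(v in X) \sum_(v' in X) q v v' * (h v * h v').
  rewrite /expect; under eq_bigr do rewrite expr2 big_distrlr /= mulr_sumr.
  rewrite exchange_big; apply: eq_bigr => v _ /=.
  under eq_bigr do rewrite mulr_sumr.
  rewrite exchange_big; apply: eq_bigr => v' _ /=.
  rewrite /q /Wt [X in X * _]big_mkcond mulr_suml; apply: eq_bigr => t _.
  rewrite subUset sub1set sub1 /u.
  by case: (s \subset t); case: (v \in t); case: (v' \in t) => /=; ring.
rewrite (eq_bigr (fun v => p v * h v ^+ 2 + \sum_(v' in X | v' != v) q v v' * (h v * h v'))); last first.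
  by move=> v vX; rewrite (bigD1 v) //= q1 expr2.
by rewrite big_split /= mulrDl mul1r lerD2l.
Qed.

Lemma cells1 t v : 0 < w t -> v \in t -> cells (col v) t = [set v].
Proof.
move=> wt vt; apply/setP => v'; rewrite !inE; apply/andP/eqP => [[v't /eqP]|-> //].
exact: (col_inj wt).
Qed.

(** The centered [F] and [G] become one function [h] on the link vertices, living on the colors [i]
    and [j]. Then [sum_link h] is their sum, and the bound on its second moment leaves the
    covariance once the squares are subtracted. *)
Lemma expands_link K i j (mu : R) : one_sided_link_expander d w mu -> mu < 1 ->
  (#|K| < d)%N -> i \notin K -> j \notin K -> i != j ->
  expands cells w K [set i] [set j] ((d - #|K|)%:R * mu).
Proof.
move=> expd mu1 Kd iK jK ij t0 F G dF dG; set u := pinned cells w K t0.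
have [t1 ut1|u0] := pickP (fun t => u t != 0); last first.
  have ez H : expect u H = 0 by apply: big1 => t _; have /negbFE/eqP -> := u0 t; rewrite mul0r.
  by rewrite /cov !ez !mul0r subr0 addr0 !mulr0.
have uw t : u t != 0 -> 0 < w t /\ agree cells K t0 t.
  by rewrite /u /pinned; case: ifP => [a /wN0|_] //; rewrite eqxx.
have [wt1 a1] := uw _ ut1; pose s := restr K t1.
have uE t : u t = if s \subset t then w t else 0.
  have [wt|/wN0 wt] := eqVneq (w t) 0; first by rewrite /u /pinned wt !if_same.
  rewrite /u /pinned; congr (if _ then _ else _).
  have := restrP K s wt; rewrite col_restr // eqxx /= => ->.
  apply/idP/eqP => [/restr_agree <-|e]; first by rewrite /s -(restr_agree a1).
  by apply: agree_restr; rewrite -e (restr_agree a1).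
have cs : #|s| = #|K|.
  rewrite -(col_restr K wt1) card_in_imset // => v v' vs vs'.
  by apply: (col_inj wt1); apply: (subsetP (restr_sub K t1)).
have ug t : 0 <= u t by apply: pinned_ge0.
have W0 : expect u (fun=> 1) != 0.
  rewrite gt_eqF // /expect (bigD1 t1) //= ltr_pwDl ?mulr1 //; first by rewrite lt0r ut1 ug.
  by apply: sumr_ge0 => t _; rewrite mulr1.
pose ctr H t := H t - expect u H / expect u (fun=> 1); pose F0 := ctr F; pose G0 := ctr G.
have covE H H' : cov u H H' = expect u (fun t => ctr H t * ctr H' t) by apply: cov_centered.
rewrite !covE -/F0 -/G0.
have dF0 : depends_on cells (K :|: [set i]) F0 by move=> t t' /dF; rewrite /F0 /ctr => ->.
have dG0 : depends_on cells (K :|: [set j]) G0 by move=> t t' /dG; rewrite /G0 /ctr => ->.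
have ctr0 H : expect u (ctr H) = 0.
  have -> : expect u (ctr H) =
      expect u (fun t => H t + (- (expect u H / expect u (fun=> 1))) * 1).
    by apply: eq_bigr => t _; rewrite /ctr; ring.
  by rewrite expectD; field.
(* Any top face of the link through [v] serves: with [K] frozen, [F] and [G] see only their own
   vertex. *)
pose rep v := odflt t1 [pick t | (u t != 0) && (v \in t)].
have repE k (H : {set V} -> R) t v : depends_on cells (K :|: [set k]) H -> u t != 0 -> v \in t ->
    col v = k -> H (rep v) = H t.
  move=> dH ut vt ck; rewrite /rep; case: pickP => [t' /andP [ut' vt']|/(_ t)]; last by rewrite ut vt.
  have [[wt a] [wt' a']] := (uw _ ut, uw _ ut').
  apply: dH; apply/agreeP => l; rewrite !inE => /orP [lK|/eqP ->].
    by rewrite -(agreeP _ _ _ _ a) // -(agreeP _ _ _ _ a').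
  by rewrite -ck !cells1.
pose h v := if col v == i then F0 (rep v) else if col v == j then G0 (rep v) else 0.
(* Used for the identity and for squaring. *)
have key (g : R -> R) t : g 0 = 0 -> u t != 0 ->
    \sum_(v in link_vert w s) (v \in t)%:R * g (h v) = g (F0 t) + g (G0 t).
  move=> g0 ut; have [wt a] := uw _ ut.
  have st : s \subset t by move: ut; rewrite uE; case: ifP; rewrite ?eqxx.
  have inX v : v \in t -> col v \notin K -> v \in link_vert w s.
    move=> vt vK; rewrite inE inE (negPf vK) andbF /=.
    by apply: (Wt_gt0 wt); rewrite subUset sub1set vt st.
  have [[vi vit ci] [vj vjt cj]] := (col_ex i wt, col_ex j wt).
  have vji : vj != vi by apply: contraNneq ij => e; rewrite -ci -cj e.
  rewrite (bigD1 vi) ?inX ?ci //= (bigD1 vj) ?vji ?inX ?cj //= big1 => [|v].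
    rewrite addr0 vit vjt !mul1r /h ci cj eqxx (eq_sym j) (negPf ij) eqxx.
    by rewrite (repE i _ t) // (repE j _ t).
  move=> /andP [/andP [_ vvi] vvj].
  have [vt|] := boolP (v \in t); last by rewrite mul0r.
  rewrite /h !ifN ?g0 ?mulr0 //; first by
    apply: contraNneq vvj => e; apply/eqP/(col_inj wt); rewrite ?e ?cj.
  by apply: contraNneq vvi => e; apply/eqP/(col_inj wt); rewrite ?e ?ci.
have fs : is_face w s by apply: (Wt_gt0 wt1); apply: restr_sub.
have := link_second_moment (h := h) expd mu1 fs; rewrite cs => /(_ Kd) /=.
rewrite -(eq_expect (u := u) (F := fun t => F0 t + 1 * G0 t) uE); last first.
  by move=> t ut; rewrite (key id) // mul1r.
rewrite -(eq_expect (u := u) (F := fun t => (F0 t * F0 t + 2 * (F0 t * G0 t)) + 1 * (G0 t * G0 t)) uE); last first.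
  by move=> t ut; rewrite (key id) //; ring.
rewrite -(eq_expect (u := u) (F := fun t => F0 t * F0 t + 1 * (G0 t * G0 t)) uE); last first.
  by move=> t ut; rewrite (key (fun x => x ^+ 2)) ?expr0n //; ring.
rewrite !expectD !mul1r !ctr0 addr0 => /(_ erefl).
lra.
Qed.

End Complex.

(** * The colored walk as a covariance *)

Theorem theorem7p1 (R : rcfType) (V : finType) (d : nat)
  (w : {set V} -> R) (col : V -> 'I_d.+1) (lam : R) (I J : {set 'I_d.+1}) :
  0 < lam -> lam < 1 / 2 ->
  is_weighted_complex d w ->
  is_partite w col ->
  one_sided_link_expander d w (lam / (d.+1%:R * lam + 1)) ->
  I != set0 -> J != set0 -> [disjoint I & J] ->
  colwalk_lambda_le w col I J ((#|I| * #|J|)%:R * lam).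
Proof.
move=> lam0 lam2 wP colP expd I0 J0 IJ f g nf ng f0.
have w0 t : 0 <= w t by case: wP.
have den : 0 < d.+1%:R * lam + 1 by rewrite ltr_wpDl // mulr_ge0 // ltW.
have mu1 : lam / (d.+1%:R * lam + 1) < 1.
  rewrite ltr_pdivrMr // mul1r -natr1.
  have : 0 <= d%:R * lam by rewrite mulr_ge0 // ltW.
  by lra.
have base (K : {set 'I_d.+1}) i j Kd iK jK ij :=
  expands_link wP colP expd mu1 (K := K) (i := i) (j := j) Kd iK jK ij.
have ex2 := expands_colors w0 (card_ord _) lam0 lam2 base I0 J0 IJ.
rewrite ip_colwalkE //.
have sq K (e : {set V} -> R) : norm_col w col K e = 1 ->
    expect w (fun t => e (restr col K t) * e (restr col K t)) = 1.
  rewrite /norm_col ip_colE // => ne; rewrite -[LHS]sqr_sqrtr ?ne ?expr1n //.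
  by apply: sumr_ge0 => t _; rewrite mulr_ge0 // -expr2 sqr_ge0.
have pinE : pinned (cells col) w set0 set0 =1 w.
  by move=> t; rewrite /pinned; case: agreeP => // [] []; move=> i; rewrite inE.
have dep K (e : {set V} -> R) : depends_on (cells col) (set0 :|: K) (fun t => e (restr col K t)).
  by move=> t t'; rewrite set0U => /restr_agree ->.
have := ex2 set0 _ _ (dep I g) (dep J f).
rewrite !(eq_cov pinE (fun _ _ => erefl) (fun _ _ => erefl)) => le.
have fm : expect w (fun t => f (restr col J t)) = 0.
  by rewrite -f0 ip_colE //; apply: eq_bigr => t _; rewrite mulr1.
have vf : cov w (fun t => f (restr col J t)) (fun t => f (restr col J t)) = 1.
  by rewrite /cov fm !mul0r subr0 sq.
(* Only [f] is centered, so the variance of [g] is merely at most 1. *)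
have vg : cov w (fun t => g (restr col I t)) (fun t => g (restr col I t)) <= 1.
  rewrite /cov sq // lerBlDr lerDl divr_ge0 // -?expr2 ?sqr_ge0 //.
  by apply: sumr_ge0 => t _; rewrite mulr1.
have cv : cov w (fun t => g (restr col I t)) (fun t => f (restr col J t)) =
    expect w (fun t => f (restr col J t) * g (restr col I t)).
  by rewrite covC /cov fm !mul0r subr0.
have c0 : 0 <= (#|I| * #|J|)%:R * lam by rewrite mulr_ge0 // ltW.
move: le; rewrite cv vf; set E := expect w _; set c := _ * lam in c0 *; set vG := cov _ _ _ in vg *.
move=> le; have : c * vG <= c by rewrite -[leRHS]mulr1 ler_wpM2l.
by lra.
Qed.
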